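(* Let $m\ge 2$ be an integer with $\gcd(3,m)=1$, and let $v\in\mathbb{F}_{2^{3m}}^*$ satisfy $\mathrm{tr}_m^{3m}(v)=0$. Then the monomial $v\,x^{2^{3m-1}+2^{3m-2}-2^{2m-2}-2^{m-2}}$ is a complete permutation polynomial over $\mathbb{F}_{2^{3m}}$.
   Context: A polynomial $f\in\mathbb{F}_Q[x]$ is a complete permutation polynomial over $\mathbb{F}_Q$ if both $f(x)$ and $f(x)+x$ induce bijections of $\mathbb{F}_Q$. $\mathrm{tr}_m^{3m}(x)=x+x^{2^m}+x^{2^{2m}}$ is the relative trace from $\mathbb{F}_{2^{3m}}$ to $\mathbb{F}_{2^m}$. *)

(* Defs.v *)
From mathcomp Require Import all_boot all_order all_algebra all_field.

Set Implicit Arguments.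
Unset Strict Implicit.
Unset Printing Implicit Defensive.

Import GRing.Theory.
Local Open Scope ring_scope.

Definition complete_permutation_poly (F : finFieldType) (f : {poly F}) : Prop :=
  bijective (fun x : F => f.[x]) /\ bijective (fun x : F => (f + 'X).[x]).

(* The trace to the subfield of order 2 ^ m when #|F| = 2 ^ (3 * m), given by
   its explicit formula; its values are left in F. *)
Definition rel_trace (F : finFieldType) (m : nat) (x : F) : F :=
  x + x ^+ (2 ^ m) + x ^+ (2 ^ (2 * m)).

(* Main.v *)
(** Write [q = 2 ^ m] and let [N] be the norm from the field of order [q ^ 3]
    to the field of order [q]. With [t = N(x)^(1/4)], which lies in the subfield,
    the monomial is [v x / t]. As [N(x / t) = t], it is a permutation. Moreover
    [N(v x / t + x) = t N(v + t) = t (t + v) (t + v^q) (t + v^(q^2))], and since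
    [v] has trace 0 this is an additive polynomial in [t]; a nonzero root [t] in
    the subfield would give [v] in the subfield, so that [0 = tr v = 3 v = v].
    Hence the value of [v x / t + x] determines first [t] and then [x]. *)
Require Import Defs.
From mathcomp Require Import all_boot all_order all_algebra all_field.
From mathcomp Require Import ring zify.

Import GRing.Theory.
Local Open Scope ring_scope.

Definition cubic_norm {R : comNzRingType} (q : nat) (x : R) : R :=
  x * x ^+ q * x ^+ (q ^ 2).

Lemma cubic_normM {R : comNzRingType} (q : nat) (x y : R) :
  cubic_norm q (x * y) = cubic_norm q x * cubic_norm q y.
Proof. by rewrite /cubic_norm !exprMn; ring. Qed.

Lemma cubic_norm_fixed {R : comNzRingType} (q : nat) (s : R) :
  s ^+ q = s -> cubic_norm q s = s ^+ 3.
Proof. by move=> sq; rewrite /cubic_norm -mulnn exprM !sq; ring. Qed.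

Lemma cubic_norm0 {R : comNzRingType} (q : nat) : cubic_norm q (0 : R) = 0.
Proof. by rewrite /cubic_norm !mul0r. Qed.

(** The cubic coefficient of [L] is [a + b + c], so [L z] is z^4 + (ab + bc + ca) z^2 + abc z; only
    exponents 1, 2, 4 remain, whence additivity in characteristic 2. *)
Lemma trace0_quartic_sub {R : comNzRingType} (a b c s u : R) :
  2 \in [pchar R] -> a + b + c = 0 ->
  let L z := z * ((a + z) * (b + z) * (c + z)) in L s - L u = L (s - u).
Proof.
move=> ch2 abc /=; have -> : c = - (a + b) by apply/eqP; rewrite -addr_eq0 addrC abc.
set e := - (a ^+ 2 + a * b + b ^+ 2).
have two0 : 2%:R = 0 :> R by exact: pcharf0.
(* With [c] eliminated, [e] is ab + bc + ca, and [L s - L u] exceeds [L (s - u)] by twice an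
   explicit polynomial. *)
transitivity ((s - u) * ((a + (s - u)) * (b + (s - u)) * (- (a + b) + (s - u)))
  + 2%:R * (2%:R * s ^+ 3 * u - 3%:R * s ^+ 2 * u ^+ 2 + 2%:R * s * u ^+ 3
            - u ^+ 4 + e * (s * u - u ^+ 2))).
  by rewrite /e; ring.
by rewrite two0 mul0r addr0.
Qed.

Section CubicExtension.

Variables (F : finFieldType) (m : nat).
Hypotheses (hm : (2 <= m)%N) (hF : #|F| = (2 ^ (3 * m))%N).

Let q := (2 ^ m)%N.
Let r := (2 ^ (m - 2))%N.
Let N : F -> F := cubic_norm q.
Let d := (2 ^ (3 * m - 1) + 2 ^ (3 * m - 2) - 2 ^ (2 * m - 2) - 2 ^ (m - 2))%N.

Lemma pchar_2 : 2 \in [pchar F].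
Proof. by apply: (card_finPcharP (n := 3 * m)). Qed.

Lemma q_eq : q = (4 * r)%N.
Proof. by rewrite /q /r -(expnD 2 2) subnKC. Qed.

Lemma expf_q3 (x : F) : x ^+ (q ^ 3) = x.
Proof. by rewrite /q -expnM mulnC -hF expf_card. Qed.

Lemma frobD (x y : F) : (x + y) ^+ q = x ^+ q + y ^+ q.
Proof.
apply: exprDn_pchar; apply/pnatP; first by rewrite expn_gt0.
by move=> p pp; rewrite Euclid_dvdX // dvdn_prime2 // => /andP[/eqP-> _]; exact: pchar_2.
Qed.

(** As [q = 4 * r], raising to the power [r] inverts the fourth power on the subfield fixed by
    [x ^+ q]. *)
Definition norm_root4 (x : F) : F := N x ^+ r.

(** The power [q] permutes the three factors of the norm cyclically. *)
Lemma norm_root4_fixed (x : F) : norm_root4 x ^+ q = norm_root4 x.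
Proof.
rewrite /norm_root4 -exprM mulnC exprM; congr (_ ^+ r).
by rewrite /N /cubic_norm !exprMn -!exprM -expnSr expf_q3 mulnn; ring.
Qed.

Lemma norm_root4X4 (x : F) : norm_root4 x ^+ 4 = N x.
Proof.
rewrite /norm_root4 -exprM mulnC -q_eq /N /cubic_norm !exprMn -!exprM -expnSr.
by rewrite expf_q3 mulnn; ring.
Qed.

Lemma norm_root4_eq0 (x : F) : norm_root4 x = 0 -> x = 0.
Proof.
move=> t0; apply/eqP; move: (norm_root4X4 x); rewrite t0 expr0n /= => /esym/eqP.
by rewrite /N /cubic_norm !mulf_eq0 !expf_eq0; case: (x == 0); rewrite ?andbF.
Qed.

(** In terms of [r], [d] is 48 r^3 - 4 r^2 - r, while [q ^ 3] is 64 r^3. *)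
Lemma d_addn : (d + (1 + q + q ^ 2) * r = q ^ 3)%N.
Proof.
have r0 : (0 < r)%N by rewrite expn_gt0.
have e1 : (2 ^ (3 * m - 1) = 32 * r ^ 3)%N.
  by rewrite /r -expnM -(expnD 2 5); congr (2 ^ _)%N; lia.
have e2 : (2 ^ (3 * m - 2) = 16 * r ^ 3)%N.
  by rewrite /r -expnM -(expnD 2 4); congr (2 ^ _)%N; lia.
have e3 : (2 ^ (2 * m - 2) = 4 * r ^ 2)%N.
  by rewrite /r -expnM -(expnD 2 2); congr (2 ^ _)%N; lia.
rewrite /d e1 e2 e3 -/r q_eq !expnS !expn0; nia.
Qed.

(** Division-free form of x^d = x / t, valid also at 0. *)
Lemma monomial_mul_root (x : F) : x ^+ d * norm_root4 x = x.
Proof.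
rewrite /norm_root4 /N /cubic_norm -{2}(expr1 x) -!exprD -exprM -exprD d_addn.
exact: expf_q3.
Qed.

Lemma d_gt0 : (0 < d)%N.
Proof.
have r0 : (0 < r)%N by rewrite expn_gt0.
move: d_addn; rewrite q_eq !expnS !expn0; nia.
Qed.

(** Taking norms gives N(y) t^3 = t^4 N(z), and t^3 cancels; if t = 0 then x = 0, which the first
    hypothesis handles. *)
Lemma norm_of_mul_root (x y z : F) : (x = 0 -> y = 0) ->
  y * norm_root4 x = x * z -> N y = norm_root4 x * N z.
Proof.
move=> xy0 /(congr1 N); rewrite /N !cubic_normM (cubic_norm_fixed _ _ (norm_root4_fixed x)).
have [t0 _|tn0] := eqVneq (norm_root4 x) 0.
  by rewrite t0 mul0r xy0 ?cubic_norm0 //; exact: norm_root4_eq0.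
rewrite -/(N x) -norm_root4X4 => e; apply: (mulIf (expf_neq0 3 tn0)).
by rewrite e; ring.
Qed.

Lemma monomial_inj : injective (fun x : F => x ^+ d).
Proof.
(* The inverse is explicit: N(x^d) = t, and x^d t = x. *)
suff K : cancel (fun x : F => x ^+ d) (fun y => y * N y) by exact: can_inj K.
move=> x /=; rewrite (norm_of_mul_root x (x ^+ d) 1).
- by rewrite /N /cubic_norm !expr1n !mulr1 monomial_mul_root.
- by move=> ->; rewrite expr0n eqn0Ngt d_gt0.
- by rewrite monomial_mul_root mulr1.
Qed.

Variable v : F.
Hypotheses (hv : v != 0) (htr : rel_trace m v = 0).

Lemma trace0_not_fixed : v ^+ q != v.
Proof.
apply: contra hv => /eqP vq; move: htr.
rewrite /rel_trace -/q mulnC expnM -/q -mulnn exprM !vq => vvv.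
by rewrite -vvv -addrA (addrr_pchar2 pchar_2) addr0.
Qed.

Lemma addv_fixed_neq0 (s : F) : s ^+ q = s -> v + s != 0.
Proof.
move=> sq; apply: contra trace0_not_fixed; rewrite addr_eq0.
by rewrite (oppr_pchar2 pchar_2) => /eqP ->; rewrite sq.
Qed.

Lemma norm_addv_fixed (s : F) : s ^+ q = s ->
  N (v + s) = (v + s) * (v ^+ q + s) * (v ^+ (q ^ 2) + s).
Proof.
by move=> sq; rewrite /N /cubic_norm -mulnn !exprM !frobD !sq.
Qed.

Lemma fixed_mul_norm_inj (s u : F) : s ^+ q = s -> u ^+ q = u ->
  s * N (v + s) = u * N (v + u) -> s = u.
Proof.
move=> sq uq e.
have suq : (s - u) ^+ q = s - u by rewrite (oppr_pchar2 pchar_2) frobD sq uq.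
have tr0 : v + v ^+ q + v ^+ (q ^ 2) = 0.
  by move: htr; rewrite /rel_trace -/q mulnC expnM.
(* Additivity turns equal values at [s] and [u] into a zero at [s - u], where the norm factor cannot
   vanish. *)
have := trace0_quartic_sub _ _ _ s u pchar_2 tr0.
rewrite /= -!norm_addv_fixed // e subrr => /esym/eqP.
rewrite mulf_eq0 subr_eq0 => /orP[/eqP //|].
rewrite /N /cubic_norm !mulf_eq0 !expf_eq0.
by rewrite (negPf (addv_fixed_neq0 _ suq)) !andbF.
Qed.

Lemma monomial_add_inj : injective (fun x : F => v * x ^+ d + x).
Proof.
have gT (x : F) : (v * x ^+ d + x) * norm_root4 x = x * (v + norm_root4 x).
  by rewrite mulrDl -mulrA monomial_mul_root; ring.
have Ng (x : F) : N (v * x ^+ d + x) = norm_root4 x * N (v + norm_root4 x).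
  apply: norm_of_mul_root => // ->.
  by rewrite expr0n eqn0Ngt d_gt0 mulr0 addr0.
move=> x y /= e.
have Txy : norm_root4 x = norm_root4 y.
  by apply: fixed_mul_norm_inj; rewrite ?norm_root4_fixed // -!Ng e.
(* Multiplying the common value by the common t gives x (v + t) = y (v + t). *)
apply: (mulIf (addv_fixed_neq0 _ (norm_root4_fixed x))).
by rewrite -gT e Txy gT.
Qed.

End CubicExtension.

Theorem theorem7 (F : finFieldType) (m : nat) (v : F)
    (hm : (2 <= m)%N) (h3m : coprime 3 m) (hF : #|F| = (2 ^ (3 * m))%N)
    (hv : v != 0) (htr : rel_trace m v = 0) :
  complete_permutation_poly
    (v *: 'X^(2 ^ (3 * m - 1) + 2 ^ (3 * m - 2)
              - 2 ^ (2 * m - 2) - 2 ^ (m - 2))).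
Proof.
split; apply: injF_bij => x y; rewrite !hornerE ?hornerXn.
  by move=> /(mulfI hv); exact: monomial_inj.
exact: monomial_add_inj.
Qed.
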